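(* Let $d=1$, let $F=\{\mathbf{p}_0,\ldots,\mathbf{p}_n\}\subset\mathbb{R}$ contain at least two distinct points, and let $k\ge1$. Then for every $(\lambda_0,\ldots,\lambda_n)\in\mathcal{P}_k$, for the IFS $S_i(x)=\lambda_ix+(1-\lambda_i)\mathbf{p}_i$ ($i=0,\ldots,n$), the set $X_k$ contains an open dense subset of $X$ and Lebesgue almost every $x\in X$ belongs to $X_k$.
   Context: Write $\mathcal{D}=\{0,\ldots,n\}$ and $\mathcal{P}_k=\{(\lambda_i)_{i\in\mathcal{D}}:\lambda_i\in(0,1),\ \prod_{i\in\mathcal{D}}\lambda_i^{k(n+1)^{k-1}}\ge\frac{1}{2}\}$. $X\subset\mathbb{R}$ is the unique non-empty compact set with $X=\bigcup_{i\in\mathcal{D}}S_i(X)$; ''open dense subset of $X$'' refers to the relative topology of $X$. The coding map is $\pi(\mathbf{a})=\lim_{j\to\infty}(S_{a_1}\circ\cdots\circ S_{a_j})(0)$. For $\mathbf{b}\in\mathcal{D}^k$, $\mathrm{freq}_{\mathbf{b}}(\mathbf{a})=\lim_{m\to\infty}\frac1m\#\{1\le j\le m:a_j\cdots a_{j+k-1}=\mathbf{b}\}$; $\mathbf{a}$ is $k$-simply normal if this equals $(n+1)^{-k}$ for all $\mathbf{b}\in\mathcal{D}^k$. $X_k$ is the set of $x\in X$ having a $k$-simply normal $\mathbf{a}$ with $\pi(\mathbf{a})=x$. *)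

(* Defs.v *)
From HB Require Import structures.
From mathcomp Require Import all_boot all_order all_algebra.
From mathcomp Require Import all_classical all_reals all_analysis.
Set Implicit Arguments. Unset Strict Implicit. Unset Printing Implicit Defensive.
Import Order.TTheory GRing.Theory Num.Theory numFieldNormedType.Exports.
Local Open Scope classical_set_scope.
Local Open Scope ring_scope.

Section Defs.
Variables (R : realType) (n : nat).

Definition Smap (lam p : 'I_n.+1 -> R) (i : 'I_n.+1) (x : R) : R :=
  lam i * x + (1 - lam i) * p i.

(* Sequences a_1 a_2 ... are represented by a : nat -> 'I_n.+1 with a_{j+1} = a j.
   compj a j x = (S_{a_1} o ... o S_{a_j})(x). *)
Fixpoint compj (lam p : 'I_n.+1 -> R) (a : nat -> 'I_n.+1) (j : nat) (x : R) : R :=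
  match j with
  | 0 => x
  | j'.+1 => compj lam p a j' (Smap lam p (a j') x)
  end.

Definition freq_m (k : nat) (a : nat -> 'I_n.+1) (b : 'I_k -> 'I_n.+1) (m : nat) : R :=
  (#|[set j : 'I_m | [forall t : 'I_k, a (j + t)%N == b t]]|%:R) / m%:R.

Definition simply_normal (k : nat) (a : nat -> 'I_n.+1) : Prop :=
  forall b : 'I_k -> 'I_n.+1,
    (fun m => freq_m a b m) @ \oo --> (((n.+1)%:R : R) ^- k).

Definition codes (lam p : 'I_n.+1 -> R) (a : nat -> 'I_n.+1) (x : R) : Prop :=
  (fun j => compj lam p a j 0) @ \oo --> x.

Definition Xk (lam p : 'I_n.+1 -> R) (k : nat) (X : set R) : set R :=
  [set x | X x /\ exists a, simply_normal k a /\ codes lam p a x].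

Definition inPk (k : nat) (lam : 'I_n.+1 -> R) : Prop :=
  (forall i, 0 < lam i < 1) /\
  (1/2 <= \prod_(i < n.+1) lam i ^+ (k * (n.+1) ^ k.-1)%N).

Definition is_attractor (lam p : 'I_n.+1 -> R) (X : set R) : Prop :=
  X !=set0 /\ compact X /\ X = \bigcup_(i in [set: 'I_n.+1]) (Smap lam p i @` X).
End Defs.

(* Main.v *)
Require Import Defs.
From HB Require Import structures.
From mathcomp Require Import all_boot all_order all_algebra zify ring lra.
From mathcomp Require Import all_classical all_reals all_analysis.
From mathcomp Require Import measurable_realfun.
Set Implicit Arguments. Unset Strict Implicit. Unset Printing Implicit Defensive.
Import Order.TTheory GRing.Theory Num.Theory numFieldNormedType.Exports.
Local Open Scope classical_set_scope.
Local Open Scope ring_scope.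

(* List all words of length k in lexicographic order. In this cyclic list, of
   length L = k (n+1)^k, every word of length k occurs exactly k times as a
   window. Cut the cycle at block 0 or at block 1: these blocks differ only in
   their last letter, so every concatenation of the two resulting words still
   has k occurrences of each window in every L consecutive starting positions,
   and is therefore k-simply normal. Both words contract by
   prod_i lambda_i^(k (n+1)^(k-1)) >= 1/2, so the images of the interval [al, be]
   between their fixed points cover it, and every point of [al, be] has a
   k-simply normal address. Let U be the union of the images of ]al, be[ under
   all finite compositions of the S_i. It is open, dense in X and contained in
   X_k, and it meets every interval centred near X in a fixed proportion, so
   that X \ U is porous, hence null. The cycle is written with the digits
   shifted so that block 0 spells the letter with the leftmost p_i, which makes
   the two fixed points distinct. *)

(** * Arithmetic of base [B] digits *)

(** Passing from [B ^ d] to [B ^ d.+1] only adds the digit at place [d]. This rebuilds a block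
    number from the digits seen through a window. *)
Lemma modn_expn_digits (B c d x y : nat) : x = y %[mod B ^ c] -> (c <= d)%N ->
  (forall j, (c <= j < d)%N -> x %/ B ^ j = y %/ B ^ j %[mod B]) ->
  x = y %[mod B ^ d].
Proof.
move=> xyc; elim: d => [|d IHd] cd digits; first by rewrite expn0 !modn1.
case: (ltngtP c d.+1) cd => // [cd _|<- //].
have {IHd}IHd : x = y %[mod B ^ d].
  by apply: IHd => [//|j /andP[cj jd]]; apply: digits; rewrite cj ltnW.
have step (z : nat) : (z %% B ^ d.+1 = z %/ B ^ d %% B * B ^ d + z %% B ^ d)%N.
  rewrite modn_divl -expnS [LHS](divn_eq _ (B ^ d)) modn_dvdm //.
  by rewrite expnS dvdn_mull.
by rewrite !step IHd digits // -ltnS cd leqnn.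
Qed.

Lemma big_nat_block (T : Type) (idx : T) (op : Monoid.law idx) (n l : nat)
    (F : nat -> T) :
  \big[op/idx]_(0 <= i < n * l) F i =
  \big[op/idx]_(0 <= i < n) \big[op/idx]_(0 <= j < l) F (i * l + j)%N.
Proof.
rewrite big_nat_mul; apply: eq_bigr => i _.
rewrite -{1}[(i * l)%N]add0n big_addn mulSn addnK.
by apply: eq_bigr => j _; rewrite addnC.
Qed.

(** Writing [m = (i * B + d) * B ^ t + c] with [c < B ^ t] isolates the digit [d] at place [t],
    which takes each value [B ^ k.-1] times. *)
Lemma prod_digit (S : comPzSemiRingType) (B k t : nat) (g : nat -> S) :
  (0 < B)%N -> (t < k)%N ->
  \prod_(0 <= m < B ^ k) g ((m %/ B ^ t) %% B)%N =
  (\prod_(0 <= d < B) g d) ^+ (B ^ k.-1).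
Proof.
move=> B0 tk.
have -> : (B ^ k = B ^ (k.-1 - t) * (B * B ^ t))%N.
  by rewrite -expnS -expnD; congr (_ ^ _)%N; lia.
have -> : (B ^ k.-1 = B ^ t * B ^ (k.-1 - t))%N.
  by rewrite -expnD; congr (_ ^ _)%N; lia.
rewrite big_nat_block exprM -[X in _ ^+ X]subn0 -prodr_const_nat.
apply: eq_bigr => i _.
rewrite big_nat_block -prodrXl big_nat [RHS]big_nat; apply: eq_bigr => d dB.
rewrite big_nat (eq_bigr (fun=> g d)) -?big_nat ?prodr_const_nat ?subn0//.
move=> c ct; congr (g _).
rewrite mulnA addnA -mulnDl divnMDl ?expn_gt0 ?B0// divn_small// addn0.
by rewrite modnMDl modn_small.
Qed.

(** * The cyclic list of words and its windows *)

Section Letters.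
Variables (n k : nat) (i0 : 'I_n.+1).
Hypothesis n0 : (0 < n)%N.
Local Notation B := (n.+1).
Local Notation N := (B ^ k)%N.
Local Notation L := (N * k)%N.

(* Block [m] spells [m mod N] in base [n+1], most significant digit first
   ([t = 0]), with every digit shifted by [i0] modulo [n+1]; in particular
   block 0 is [i0 ... i0]. *)
Definition letter (m t : nat) : 'I_n.+1 := inZp (m %/ B ^ (k.-1 - t)) + i0.

(* The blocks [e, e+1, ..., e+N-1] in this order, where [e] is 0 or 1. *)
Definition block_word (e : bool) : seq 'I_n.+1 :=
  mkseq (fun r => letter (r %/ k + e) (r %% k)) L.

Definition block_seq (e : nat -> bool) (j : nat) : 'I_n.+1 :=
  letter (j %% L %/ k + e (j %/ L)%N) (j %% k).

Lemma letter_inj (x y t : nat) : letter x t = letter y t ->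
  x %/ B ^ (k.-1 - t) = y %/ B ^ (k.-1 - t) %[mod B].
Proof. by move=> /addIr/(congr1 val). Qed.

Lemma letterN (t : nat) : (t < k)%N -> forall x : nat, letter (N + x) t = letter x t.
Proof.
move=> tk x; rewrite /letter; congr (_ + _); apply: val_inj => /=.
have -> : (N = B ^ t * B * B ^ (k.-1 - t))%N.
  by rewrite -expnSr -expnD; congr (_ ^ _)%N; lia.
by rewrite divnMDl ?expn_gt0// modnMDl.
Qed.

(* Blocks 0 and 1 share their first [k-1] letters, so a window that starts in
   one word and ends in the next does not see which word comes next. *)
Lemma letter_bool (e : bool) (t : nat) : (t < k.-1)%N -> letter e t = letter 0 t.
Proof.
move=> tk; rewrite /letter; congr (_ + _); apply: val_inj => /=.
rewrite div0n divn_small//; apply: (@leq_trans (B ^ 1)).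
  by rewrite expn1; case: e.
by rewrite leq_exp2l//; lia.
Qed.


Hypothesis k0 : (0 < k)%N.

Let N0 : (0 < N)%N. Proof. by rewrite expn_gt0. Qed.
Let L0 : (0 < L)%N. Proof. by rewrite muln_gt0 N0. Qed.

Lemma letter0 (t : nat) : letter 0 t = i0.
Proof. by rewrite /letter div0n; apply: val_inj => /=; rewrite mod0n add0n modn_small. Qed.

Lemma block_seqE (e : nat -> bool) (q m t : nat) : (m < N)%N -> (t < k)%N ->
  block_seq e (q * L + (m * k + t)) = letter (m + e q) t.
Proof.
move=> mN tk; have mtL : (m * k + t < L)%N.
  by rewrite (@leq_trans (m.+1 * k)) ?leq_mul2r ?mN ?orbT// mulSn; lia.
rewrite /block_seq modnMDl divnMDl// (divn_small mtL) (modn_small mtL) addn0.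
by rewrite divnMDl// (divn_small tk) addn0 mulnA addnA -mulnDl modnMDl modn_small.
Qed.

Lemma mkseq_block_seq (e : nat -> bool) (q : nat) :
  mkseq (fun r => block_seq e (q * L + r)) L = block_word (e q).
Proof.
apply: (@eq_from_nth _ i0); rewrite !size_mkseq// => r rL.
by rewrite !nth_mkseq// {1}(divn_eq r k) block_seqE ?ltn_mod// ltn_divLR.
Qed.

(** Starting at block 1 moves block 0 to the end, since block [N] spells the same letters as block
    0. *)
Lemma block_word_rot : block_word true = rot k (block_word false).
Proof.
have kL : (k <= L)%N by rewrite leq_pmull.
apply: (@eq_from_nth _ i0); rewrite ?size_rot !size_mkseq// => r rL.
rewrite /rot nth_cat size_drop size_mkseq nth_drop nth_mkseq//.
have [rk|rk] := ltnP r (L - k).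
  rewrite nth_mkseq; last by lia.
  by have := divnMDl 1 r k0; rewrite mul1n => ->; rewrite modnDl addn0 addnC.
have rLk : (r = N.-1 * k + (r - (L - k)))%N.
  by rewrite -subn1 mulnBl mul1n; lia.
rewrite nth_take; last by lia.
have ck : (r - (L - k) < k)%N by lia.
rewrite nth_mkseq; last by lia.
rewrite (divn_small ck) (modn_small ck) {1 2}rLk divnMDl// modnMDl.
rewrite (divn_small ck) (modn_small ck) !addn0 addn1 prednK//.
by have := letterN ck 0%N; rewrite addn0.
Qed.

Lemma take_block_word : take k (block_word false) = nseq k i0.
Proof.
have kL : (k <= L)%N by rewrite leq_pmull.
apply: (@eq_from_nth _ i0); rewrite ?size_takel ?size_mkseq ?size_nseq// => r rk.
rewrite nth_take// nth_mkseq; last exact: leq_trans kL.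
by rewrite divn_small// letter0 nth_nseq rk.
Qed.

(** Block [j - i0] ends in the letter [j]. *)
Lemma mem_block_word (e : bool) (j : 'I_n.+1) : j \in block_word e.
Proof.
suff jw : j \in block_word false by case: e; rewrite ?block_word_rot ?mem_rot.
have dN : (nat_of_ord (j - i0)%R < N)%N.
  by rewrite (leq_trans (ltn_ord _))// -{1}[B]expn1 leq_exp2l.
apply/mapP; exists ((j - i0)%R * k + k.-1)%N.
  rewrite mem_iota add0n leq0n; move: dN; generalize (nat_of_ord (j - i0)%R).
  move=> d dN; apply: (@leq_trans (d.+1 * k)); first by rewrite mulSn; lia.
  by rewrite leq_mul2r dN orbT.
rewrite divnMDl// modnMDl (@divn_small k.-1) ?modn_small ?prednK// !addn0.
rewrite /letter subnn expn0 divn1 -[LHS](subrK i0); congr (_ + _).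
by apply: val_inj => /=; rewrite modn_mod.
Qed.

(** At each of the [k] places every letter appears in [B ^ k.-1] blocks. With [f := lam] this is the
    product bounded below in [inPk]. *)
Lemma prod_block_word (S : comPzSemiRingType) (f : 'I_n.+1 -> S) (e : bool) :
  \prod_(i <- block_word e) f i = \prod_i f i ^+ (k * B ^ k.-1).
Proof.
have -> : \prod_(i <- block_word e) f i = \prod_(i <- block_word false) f i.
  by case: e => //; apply: perm_big; rewrite block_word_rot perm_rot.
rewrite big_map -[L in iota 0 L]subn0 -/(index_iota 0 L) big_nat_block.
rewrite exchange_big.
have E t : (t < k)%N ->
  \prod_(0 <= m < N) f (letter ((m * k + t) %/ k + false) ((m * k + t) %% k)) =
  (\prod_i f i) ^+ (B ^ k.-1).
  move=> tk; rewrite (eq_bigr (fun m => (fun d => f (inZp d + i0))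
    ((m %/ B ^ (k.-1 - t)) %% B)%N)); last first.
    move=> m _; rewrite divnMDl// modnMDl (divn_small tk) modn_small// !addn0.
    by congr (f (_ + _)); apply: val_inj => /=; rewrite modn_mod.
  rewrite (prod_digit (fun d => f (inZp d + i0)))//; last by lia.
  congr (_ ^+ _); rewrite big_mkord [RHS](reindex_inj (addIr i0)).
  by apply: eq_bigr => d _; rewrite valZpK.
rewrite big_nat (eq_bigr (fun=> (\prod_i f i) ^+ (B ^ k.-1))) -?big_nat.
  by rewrite prodr_const_nat subn0 -exprM mulnC prodrXl.
by move=> t tk; apply: E.
Qed.

(** The low digits of a block [x] give [x + 1] modulo [B ^ (k - s)]; the high digits of [x + 1] then
    give it modulo [N], and [m < N] recovers [m]. *)
Lemma block_seq_window_inj (e : nat -> bool) (q s : nat) : (s < k)%N ->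
  injective (fun m : 'I_N =>
    [ffun t : 'I_k => block_seq e (q * L + (m * k + s) + t)]
      : {ffun 'I_k -> 'I_n.+1}).
Proof.
move=> sk.
pose w m t := block_seq e (q * L + (m * k + s) + t).
have wl m t : (m < N)%N -> (s + t < k)%N -> w m t = letter (m + e q) (s + t).
  by move=> mN stk; rewrite /w -!addnA block_seqE.
have wr m u : (m < N)%N -> (u < s)%N -> w m (k - s + u)%N = letter (m + e q).+1 u.
  move=> mN us; rewrite /w.
  have -> : (q * L + (m * k + s) + (k - s + u) = q * L + (m.+1 * k + u))%N.
    by rewrite mulSn; lia.
  have [mN1|mN1] := ltnP m.+1 N; first by rewrite block_seqE//; lia.
  (* The next block opens the next word and is block 0 or 1. Fewer than [k] of its letters are seen,
     and these agree with those of block [N + e q]. *)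
  have Em : m.+1 = N by apply/eqP; rewrite eqn_leq mN.
  rewrite Em addnA -mulSnr -[u]add0n -(mul0n k) block_seqE//; last by lia.
  rewrite mul0n add0n -addSn Em add0n letterN; last by lia.
  by rewrite !letter_bool//; lia.
move=> m1 m2 /ffunP E; apply: val_inj.
have {}E t : (t < k)%N -> w m1 t = w m2 t.
  by move=> tk; have := E (Ordinal tk); rewrite !ffunE.
(* The first [k - s] letters of a window are the low digits of its block, the
   last [s] letters are the high digits of the next block. *)
have low : m1 + e q = m2 + e q %[mod B ^ (k - s)].
  apply: (@modn_expn_digits B 0); rewrite ?modn1// => j /= jks.
  have := E (k.-1 - j - s)%N; rewrite !wl ?ltn_ord//; try lia.
  move=> /(_ ltac:(lia))/letter_inj.
  by have -> : (k.-1 - (s + (k.-1 - j - s)) = j)%N by lia.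
have all : (m1 + e q).+1 = (m2 + e q).+1 %[mod N].
  apply: (@modn_expn_digits B (k - s)); last first.
  - move=> j jks; have := E (k - s + (k.-1 - j))%N.
    rewrite !wr ?ltn_ord//; try lia.
    move=> /(_ ltac:(lia))/letter_inj.
    by have -> : (k.-1 - (k.-1 - j) = j)%N by lia.
  - by rewrite leq_subr.
  - apply/eqP; rewrite -[(m1 + _).+1]addn1 -[(m2 + _).+1]addn1 eqn_modDr.
    exact/eqP.
move/eqP: all; rewrite -!addnS eqn_modDr !modn_small ?ltn_ord//.
by move/eqP.
Qed.

(** For each offset [s < k], the injection from [N] blocks into the [N] words is a bijection, so [b]
    occurs once per offset. *)
Lemma block_seq_window_count (e : nat -> bool) (b : 'I_k -> 'I_n.+1) (q : nat) :
  (\sum_(0 <= r < L) [forall t : 'I_k, block_seq e (q * L + r + t) == b t] = k)%N.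
Proof.
rewrite big_nat_block exchange_big -[RHS]subn0 -[RHS]muln1 -sum_nat_const_nat.
rewrite big_nat [RHS]big_nat; apply: eq_bigr => s /= sk.
rewrite big_mkord.
pose w (m : 'I_N) : {ffun 'I_k -> 'I_n.+1} :=
  [ffun t : 'I_k => block_seq e (q * L + (m * k + s) + t)].
have [v wv vw] : bijective w.
  apply: inj_card_bij; first exact: block_seq_window_inj.
  by rewrite card_ffun !card_ord.
rewrite (bigD1 (v [ffun t => b t]))//= big1 => [|m mv].
  rewrite addn0; case: forallP => // -[] t.
  have /ffunP/(_ t) := vw [ffun t => b t].
  by rewrite !ffunE => ->.
case: forallP => // E; case/eqP: mv; rewrite -(wv m); congr (v _).
by apply/ffunP => t; rewrite !ffunE; apply/eqP.
Qed.

End Letters.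

(** * Bounded discrepancy and simple normality *)

Definition occurrences (T : eqType) (k : nat) (a : nat -> T) (b : 'I_k -> T)
    (m : nat) : nat :=
  (\sum_(0 <= j < m) [forall t : 'I_k, a (j + t)%N == b t])%N.

(** A discrepancy bound uniform in [m], multiplied out to stay in [nat]; unlike exact periodic
    counts, it survives prepending a letter. *)
Definition balanced (n k : nat) (a : nat -> 'I_n.+1) : Prop :=
  forall b : 'I_k -> 'I_n.+1, exists C : nat, forall m : nat,
    (occurrences a b m * n.+1 ^ k <= m + C)%N /\
    (m <= occurrences a b m * n.+1 ^ k + C)%N.

Definition scons (T : Type) (x : T) (a : nat -> T) (j : nat) : T :=
  if j is j'.+1 then a j' else x.

Lemma freq_mE (R : realType) (n k : nat) (a : nat -> 'I_n.+1)
    (b : 'I_k -> 'I_n.+1) (m : nat) :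
  freq_m R a b m = (occurrences a b m)%:R / m%:R.
Proof.
rewrite /freq_m /occurrences -sum1_card big_mkcond big_mkord; congr (_%:R / _).
apply: eq_bigr => j _; case: ifPn => [|/negP]; rewrite inE /=.
  by move=> ->.
by move/negP/negbTE => ->.
Qed.

Lemma balanced_simply_normal (R : realType) (n k : nat) (a : nat -> 'I_n.+1) :
  balanced k a -> simply_normal R k a.
Proof.
move=> bal b; have [C HC] := bal b.
set N : R := n.+1%:R ^+ k.
have N1 : 1 <= N by rewrite exprn_ege1// ler1n.
have N0 : 0 < N by apply: lt_le_trans N1.
apply/cvgrPdist_le => e e0; near=> m.
have m0 : 0 < m%:R :> R by rewrite ltr0n; near: m; exact: nbhs_infty_gt.
(* The error is at most [C / (N * m)], so [m >= C / e] suffices because [N >= 1]. *)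
have Cm : C%:R / e <= m%:R by near: m; exact: nbhs_infty_ger.
have [h1 h2] := HC m; rewrite freq_mE.
move: h1 h2; rewrite -!(ler_nat R) !natrD !natrM natrX -/N.
set o : R := (occurrences a b m)%:R => h1 h2.
have -> : N^-1 - o / m%:R = (m%:R - o * N) / (N * m%:R).
  by field; rewrite !gt_eqF.
have Nm0 : 0 < N * m%:R by rewrite mulr_gt0.
rewrite normrM normfV (gtr0_norm Nm0) ler_pdivrMr//.
apply: (@le_trans _ _ C%:R); first by rewrite ler_norml; apply/andP; split; lra.
move: Cm; rewrite ler_pdivrMr// mulrC => Cm; apply: (le_trans Cm).
by rewrite ler_pM2l// ler_peMl// ltW.
Unshelve. all: by end_near. Qed.

(** Only starting positions are split: a window that starts before [m] may run past it. *)
Lemma occurrencesD (T : eqType) (k : nat) (a : nat -> T) (b : 'I_k -> T)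
    (m r : nat) :
  occurrences a b (m + r) =
  (occurrences a b m + occurrences (fun j => a (m + j)) b r)%N.
Proof.
rewrite /occurrences (@big_cat_nat _ _ _ m)//= ?leq_addr//; congr (_ + _)%N.
rewrite -{1}[m]add0n big_addn addKn; apply: eq_bigr => j _.
by apply: congr1; apply: eq_forallb => t; rewrite addnCA addnA.
Qed.

Lemma occurrences_le (T : eqType) (k : nat) (a : nat -> T) (b : 'I_k -> T)
    (m : nat) : (occurrences a b m <= m)%N.
Proof.
rewrite -[leqRHS]subn0 -[leqRHS]muln1 -sum_nat_const_nat.
by apply: leq_sum => j _; apply: leq_b1.
Qed.

Lemma balanced_block_seq (n k : nat) (i0 : 'I_n.+1) (e : nat -> bool) :
  (0 < n)%N -> (0 < k)%N -> balanced k (block_seq k i0 e).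
Proof.
move=> n0 k0 b; set N := (n.+1 ^ k)%N.
have N0 : (0 < N)%N by rewrite expn_gt0.
have blocks (q : nat) : occurrences (block_seq k i0 e) b (q * (N * k)) = (q * k)%N.
  elim: q => [|q IHq]; first by rewrite !mul0n /occurrences big_nil.
  rewrite mulSnr occurrencesD IHq mulSnr; congr (_ + _)%N.
  rewrite -[RHS](block_seq_window_count i0 n0 k0 e b q).
  by apply: eq_bigr => j _; congr (nat_of_bool _); apply: eq_forallb => t;
    rewrite addnA.
(* Full stretches contribute no error; the last partial one has length [r < N * k] and at most [r]
   occurrences, each weighted by [N]. *)
exists (N * (N * k))%N => m.
have [q [r [-> rL]]] : exists q r, (m = q * (N * k) + r /\ r < N * k)%N.
  exists (m %/ (N * k))%N, (m %% (N * k))%N; rewrite -divn_eq ltn_mod.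
  by rewrite muln_gt0 N0.
rewrite occurrencesD blocks; have := occurrences_le (fun j =>
  block_seq k i0 e (q * (N * k) + j)) b r.
move: (occurrences _ _ _) => s sr.
have sN : (s * N <= N * (N * k))%N by rewrite mulnC leq_mul2l; lia.
have r' : (N * k <= N * (N * k))%N by rewrite leq_pmull.
by rewrite mulnDl -mulnA [(k * N)%N]mulnC; lia.
Qed.

Lemma balanced_scons (n k : nat) (i : 'I_n.+1) (a : nat -> 'I_n.+1) :
  balanced k a -> balanced k (scons i a).
Proof.
move=> bal b; have [C HC] := bal b; exists (C + n.+1 ^ k + 1)%N => -[|m].
  by rewrite /occurrences big_nil; lia.
have -> : occurrences (scons i a) b m.+1 =
    (occurrences (scons i a) b 1 + occurrences a b m)%N.
  exact: (occurrencesD _ b 1 m).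
have := occurrences_le (scons i a) b 1.
by have := HC m; nia.
Qed.

(** * Compositions of the contractions, addresses and the attractor *)

Lemma ord_argmin (d : Order.disp_t) (T : orderType d) (n : nat)
    (f : 'I_n.+1 -> T) : exists i, forall j, (f i <= f j)%O.
Proof.
have [i _ fi] := @Order.TotalTheory.arg_minP _ _ _ (ord0 : 'I_n.+1) xpredT f isT.
by exists i => j; apply: fi.
Qed.

Section Ifs.
Variables (R : realType) (n : nat) (lam p : 'I_n.+1 -> R).
Hypothesis lam01 : forall i, 0 < lam i < 1.

Definition Sword (v : seq 'I_n.+1) (x : R) : R := foldr (Smap lam p) x v.
Definition ratio (v : seq 'I_n.+1) : R := \prod_(i <- v) lam i.

Lemma lam_gt0 i : 0 < lam i. Proof. by case/andP: (lam01 i). Qed.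
Lemma lam_lt1 i : lam i < 1. Proof. by case/andP: (lam01 i). Qed.

Lemma lam_bounds : exists d D : R,
  [/\ 0 < d, 0 < D < 1 & forall i, d <= lam i <= D].
Proof.
have [i hi] := ord_argmin lam; have [j hj] := ord_argmin (fun j => - lam j).
exists (lam i), (lam j); split=> [||l]; rewrite ?lam_gt0 ?lam_lt1//.
by rewrite hi -lerN2 hj.
Qed.

Lemma ratio_gt0 v : 0 < ratio v.
Proof. by apply: prodr_gt0 => i _; apply: lam_gt0. Qed.

Lemma ratio_cons i v : ratio (i :: v) = lam i * ratio v.
Proof. exact: big_cons. Qed.

Lemma ratio_le (D : R) v : (forall i, lam i <= D) -> ratio v <= D ^+ size v.
Proof.
move=> lamD; elim: v => [|i v IHv]; first by rewrite /ratio big_nil.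
by rewrite ratio_cons exprS ler_pM// ltW ?lam_gt0 ?ratio_gt0.
Qed.

Lemma ratio_lt1 v : (0 < size v)%N -> ratio v < 1.
Proof.
move=> v0; have [d [D [_ /andP[D0 D1] lamD]]] := lam_bounds.
apply: (@le_lt_trans _ _ (D ^+ size v)).
  by apply: ratio_le => i; case/andP: (lamD i).
by rewrite exprn_ilt1 ?(ltW D0)// -lt0n.
Qed.

Lemma SwordB v x y : Sword v x - Sword v y = ratio v * (x - y).
Proof.
elim: v => [|i v IHv]; first by rewrite /ratio big_nil mul1r.
by rewrite ratio_cons -mulrA -IHv /= /Smap; ring.
Qed.

Lemma Sword_affine v x y : Sword v x = Sword v y + ratio v * (x - y).
Proof. by rewrite -SwordB addrC subrK. Qed.

Lemma Sword_cat u v x : Sword (u ++ v) x = Sword u (Sword v x).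
Proof. exact: foldr_cat. Qed.

Lemma ler_Sword v x y : (Sword v x <= Sword v y) = (x <= y).
Proof. by rewrite -subr_ge0 SwordB pmulr_rge0 ?ratio_gt0// subr_ge0. Qed.

Lemma ltr_Sword v x y : (Sword v x < Sword v y) = (x < y).
Proof. by rewrite -subr_gt0 SwordB pmulr_rgt0 ?ratio_gt0// subr_gt0. Qed.

Lemma Smap_le (K : R) i x : `|p i| <= K -> `|x| <= K -> `|Smap lam p i x| <= K.
Proof.
move=> pK xK; rewrite (le_trans (ler_normD _ _))// !normrM.
have l0 := lam_gt0 i; have l1 := lam_lt1 i.
have -> : K = lam i * K + (1 - lam i) * K by ring.
have l2 : 0 < 1 - lam i by rewrite subr_gt0.
by rewrite (gtr0_norm l0) (gtr0_norm l2) lerD// ler_pM2l.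
Qed.

Lemma Sword_le (K : R) v x : (forall i, `|p i| <= K) -> `|x| <= K ->
  `|Sword v x| <= K.
Proof. by move=> pK xK; elim: v => [//|i v]; apply: Smap_le. Qed.

Lemma compjE a j x : compj lam p a j x = Sword (mkseq a j) x.
Proof.
by elim: j x => [//|j IHj] x; rewrite [LHS]/= IHj mkseqS /Sword foldr_rcons.
Qed.

Lemma compjD a j d x : compj lam p a (j + d) x =
  compj lam p a j (Sword (mkseq (fun t => a (j + t)%N) d) x).
Proof.
elim: d x => [|d IHd] x; first by rewrite addn0.
by rewrite addnS [LHS]/= IHd mkseqS /Sword foldr_rcons.
Qed.

Lemma compj_scons i a j x :
  compj lam p (scons i a) j.+1 x = Smap lam p i (compj lam p a j x).
Proof. by elim: j x => [//|j IHj] x; rewrite [LHS]/= -IHj. Qed.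

(* [x] lies in every cylinder [S_{a_1} o ... o S_{a_m} ([-K, K])]. *)
Definition addresses (K : R) (a : nat -> 'I_n.+1) (x : R) : Prop :=
  forall m, exists2 z, `|z| <= K & x = compj lam p a m z.

(** Each [Smap] preserves [[-K, K]], so the cylinders are nested and arbitrarily large depths
    suffice. *)
Lemma addresses_cofinal K a x : (forall i, `|p i| <= K) ->
  (forall m, exists j z, [/\ (m <= j)%N, `|z| <= K & x = compj lam p a j z]) ->
  addresses K a x.
Proof.
move=> pK cof m; have [j [z [mj zK ->]]] := cof m.
rewrite -(subnKC mj) compjD.
by eexists; last reflexivity; apply: Sword_le.
Qed.

Lemma addresses_scons K i a x : (forall i, `|p i| <= K) ->
  addresses K a x -> addresses K (scons i a) (Smap lam p i x).
Proof.
move=> pK xa [|m]; last first.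
  by have [z zK ->] := xa m; exists z; rewrite ?compj_scons.
have [z zK ->] := xa 0; exists (Smap lam p i z) => //; exact: Smap_le.
Qed.

(** Cylinders shrink like [D ^ m], where [D < 1] bounds all ratios. The base point [y] is free: 0
    serves for [codes], a point of [X] for membership in [X]. *)
Lemma addresses_cvg K a x y : addresses K a x ->
  (fun j => compj lam p a j y) @ \oo --> x.
Proof.
move=> xa; have [d [D [_ /andP[D0 D1] lamD]]] := lam_bounds.
apply/cvgrPdist_le => e e0.
have D1' : `|D| < 1 by rewrite gtr0_norm.
have /cvgrPdist_le/(_ e e0) := cvg_geometric (K + `|y|) D1'.
apply: filterS => m /=; rewrite sub0r normrN; apply: le_trans.
have [z zK ->] := xa m; rewrite !compjE SwordB normrM gtr0_norm ?ratio_gt0//.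
have Ky : 0 <= K + `|y| by rewrite addr_ge0// (le_trans _ zK).
rewrite normrM (ger0_norm Ky) normrX (gtr0_norm D0) [leRHS]mulrC; apply: ler_pM => //.
- exact: ltW (ratio_gt0 _).
- rewrite -{2}(size_mkseq a m); apply: ratio_le => i.
  by case/andP: (lamD i).
- by rewrite (le_trans (ler_normB _ _))// lerD2r.
Qed.

Section Attractor.
Variable X : set R.
Hypothesis XS : X = \bigcup_(i in [set: 'I_n.+1]) (Smap lam p i @` X).

Lemma attractor_Sword v x : X x -> X (Sword v x).
Proof.
by move=> Xx; elim: v => [//|i v IHv]; rewrite XS; exists i => //; exists (Sword v x).
Qed.

Lemma attractor_addresses K a x : X !=set0 -> closed X ->
  addresses K a x -> X x.
Proof.
move=> [x0 Xx0] cX /(addresses_cvg x0); apply: closed_cvg => //.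
by apply: nearW => j; rewrite compjE; apply: attractor_Sword.
Qed.

(** Follow an address of [x] until the ratio first drops to [r] or below; the last letter multiplies
    it by at least [d]. *)
Lemma attractor_cylinder (d r x : R) : 0 <= d ->
  (forall i, d <= lam i) -> 0 < r <= 1 ->
  X x -> exists v y, [/\ X y, x = Sword v y & d * r <= ratio v <= r].
Proof.
move=> d0 lamd /andP[r0 r1].
have d1 : d <= 1 by rewrite (le_trans (lamd ord0))// ltW ?lam_lt1.
have [d' [D [_ /andP[D0 D1] lamD]]] := lam_bounds.
(* This [m] bounds the depth: replacing [r] by [r / lam i] uses up one factor [D]. *)
have [m Dm] : exists m, D ^+ m <= r.
  have D1' : `|D| < 1 by rewrite gtr0_norm.
  have /cvgrPdist_le/(_ r r0) [m _ /(_ m (leqnn m))] := cvg_expr D1'.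
  by rewrite sub0r normrN normrX (gtr0_norm D0) => Dm; exists m.
elim: m x r r0 r1 Dm => [|m IHm] x r r0 r1 Dm Xx.
  exists [::], x; split=> //; rewrite /ratio big_nil.
  by have -> : r = 1 by [apply/le_anti; rewrite r1]; rewrite mulr1 d1 lexx.
move: (Xx); rewrite {1}XS => -[i _ [y Xy <-]].
have [ri|ri] := leP (lam i) r.
  exists [:: i], y; split=> //; rewrite /ratio big_seq1 ri andbT.
  by rewrite (le_trans _ (lamd i))// ler_piMr.
have li := lam_gt0 i.
have [||||v [z [Xz -> /andP[vd vr]]]] := IHm y (r / lam i).
- by rewrite divr_gt0.
- by rewrite ler_pdivrMr// mul1r ltW.
- rewrite ler_pdivlMr// (le_trans _ Dm)// exprS mulrC ler_wpM2r ?exprn_ge0 ?(ltW D0)//.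
  by case/andP: (lamD i).
- by [].
exists (i :: v), z; split=> //; rewrite ratio_cons.
by rewrite [lam i * _]mulrC -ler_pdivrMr// -mulrA vd -ler_pdivlMr.
Qed.

End Attractor.
End Ifs.

(** * Porous sets are null *)

(* Removing a proportion [c] of an interval leaves two intervals to which the
   hypothesis applies again, so [m] rounds leave [(1 - c) ^ m] of the length. *)
Lemma porous_measure0 (R : realType) (C : set R) (A0 B0 c : R) :
  measurable (C : set (measurableTypeR R)) ->
  A0 <= B0 -> C `<=` `[A0, B0] -> 0 < c < 1 ->
  (forall a b, A0 <= a -> a < b -> b <= B0 -> exists u v,
    [/\ a <= u, u <= v, v <= b, c * (b - a) <= v - u & C `&` `]u, v[ = set0]) ->
  lebesgue_measure (C : set (measurableTypeR R)) = 0%E.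
Proof.
move=> mC AB CAB /andP[c0 c1] porous; set mu := @lebesgue_measure R.
have c1' : 0 < 1 - c by rewrite subr_gt0.
have mCI a b : measurable (C `&` `[a, b] : set (measurableTypeR R)).
  exact: measurableI.
have muI (a b : R) : a <= b -> mu `[a, b]%classic = (b - a)%:E.
  move=> ab; rewrite /mu lebesgue_measure_itv /= lte_fin; case: ltP => [//|ba].
  by rewrite (@le_anti _ _ a b) ?ab// subrr.
have decay m a b : A0 <= a -> a <= b -> b <= B0 ->
    (mu (C `&` `[a, b]) <= ((1 - c) ^+ m * (b - a))%:E)%E.
  elim: m a b => [|m IHm] a b Aa ab bB.
    rewrite expr0 mul1r -muI//.
    by apply: le_measure; rewrite ?inE//; apply: subIsetr.
  move: ab; rewrite le_eqVlt => /predU1P[<-|ab].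
    rewrite [leRHS](_ : _ = (a - a)%:E) ?subrr ?mulr0// -[0](subrr a) -muI//.
    by apply: le_measure; rewrite ?inE//; apply: subIsetr.
  have [u [v [au uv vb cuv Cuv]]] := porous a b Aa ab bB.
  apply: (@le_trans _ _ (mu ((C `&` `[a, u]) `|` (C `&` `[v, b])))).
    apply: le_measure; rewrite ?inE//; first exact: measurableU.
    move=> x [Cx]; rewrite /= !in_itv/= => /andP[ax xb].
    have [xu|ux] := leP x u; first by left; rewrite ax.
    have [vx|xv] := leP v x; first by right.
    have : (C `&` `]u, v[) x by split; rewrite //= in_itv/= ux.
    by rewrite Cuv.
  apply: le_trans (measureU2 _ (mCI _ _) (mCI _ _)) _.
  apply: le_trans (leeD (IHm a u _ _ _) (IHm v b _ _ _)) _ => //.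
  - by rewrite (le_trans uv)// (le_trans vb).
  - by rewrite (le_trans Aa)// (le_trans au).
  rewrite -EFinD lee_fin -mulrDr exprSr -mulrA ler_wpM2l ?exprn_ge0 ?(ltW c1')//.
  by lra.
apply/eqP; rewrite eq_le measure_ge0 andbT; apply/lee_addgt0Pr => e e0.
rewrite add0e.
have c1n : `|1 - c| < 1 by rewrite gtr0_norm// gtrBl.
have /cvgrPdist_le/(_ e e0) [m _ /(_ m (leqnn m))] :=
  cvg_geometric (B0 - A0) c1n.
rewrite /= sub0r normrN => Hm.
have -> : C = C `&` `[A0, B0] by rewrite (@setIidl _ C).
apply: le_trans (decay m _ _ _ _ _) _ => //.
by rewrite lee_fin (le_trans _ Hm)// mulrC ler_norm.
Qed.

(** * Coding an interval by the two words *)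

Section Coding.
Variables (R : realType) (n k : nat) (lam p : 'I_n.+1 -> R) (i0 : 'I_n.+1).
Hypothesis lam01 : forall i, 0 < lam i < 1.
Hypothesis n0 : (0 < n)%N.
Hypothesis k0 : (0 < k)%N.
Local Notation S := (Sword lam p).
Local Notation word := (block_word k i0).

(** Each map averages its argument with [p i], so it keeps values at least [c]; the letter [j] makes
    the inequality strict, and the outer maps keep it strict as [lam i > 0]. *)
Lemma Sword_gt (c x : R) (v : seq 'I_n.+1) (j : 'I_n.+1) :
  (forall i, c <= p i) -> c <= x -> j \in v -> c < p j -> c < S v x.
Proof.
move=> cp cx jv cj.
have Sge i y : c <= y -> c <= Smap lam p i y.
  move=> cy; have /andP[l0 l1] := lam01 i; rewrite -subr_ge0.
  have -> : Smap lam p i y - c = lam i * (y - c) + (1 - lam i) * (p i - c).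
    by rewrite /Smap; ring.
  by rewrite addr_ge0// mulr_ge0// ?subr_ge0// ltW.
have Swge w : c <= S w x by elim: w => [//|i w]; apply: Sge.
elim: v jv => [//|i v IHv]; rewrite inE /= => jv.
have /andP[l0 l1] := lam01 i; rewrite -subr_gt0.
have -> : Smap lam p i (S v x) - c =
    lam i * (S v x - c) + (1 - lam i) * (p i - c) by rewrite /Smap; ring.
have Sc : 0 <= S v x - c by rewrite subr_ge0.
have pc : 0 <= p i - c by rewrite subr_ge0.
have l1' : 0 < 1 - lam i by rewrite subr_gt0.
case/predU1P: jv => [ji|/IHv Sv].
  by rewrite ltr_wpDl ?mulr_ge0 ?(ltW l0)// mulr_gt0// subr_gt0 -ji.
by rewrite ltr_pwDl ?mulr_ge0 ?(ltW l1')// mulr_gt0// subr_gt0.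
Qed.

(* Word 0 starts with [i0^k] and word 1 is word 0 with this prefix moved to the
   end, so the fixed point of word 0 is the image under [S_{i0}^k] of that of
   word 1, which lies to the right of [p i0], the fixed point of [S_{i0}]. *)
Lemma fixed_points : (forall i, p i0 <= p i) -> (exists j, p i0 < p j) ->
  exists al be, [/\ al < be, S (word false) al = al & S (word true) be = be].
Proof.
move=> pmin [j pj]; set w := word true; set c := p i0.
have c_lt : c < S w c by apply: (Sword_gt pmin) pj => //; apply: mem_block_word.
have r0 := ratio_gt0 lam01 w.
have L0 : (0 < n.+1 ^ k * k)%N by rewrite muln_gt0 expn_gt0.
have r1 : ratio lam w < 1 by rewrite ratio_lt1// size_mkseq.
(* Solution of [be = S w c + ratio lam w * (be - c)]. *)
pose be := c + (S w c - c) / (1 - ratio lam w).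
have c_be : c < be by rewrite ltrDl divr_gt0 ?subr_gt0.
have wbe : S w be = be.
  by rewrite (Sword_affine _ _ _ _ c) /be; field; rewrite subr_eq0 gt_eqF.
pose u := nseq k i0; pose v := drop k (word false).
have word0 : word false = u ++ v by rewrite /u -take_block_word// cat_take_drop.
have word1 : w = v ++ u by rewrite /w block_word_rot// /rot -/v take_block_word.
exists (S u be), be; split=> //; last first.
  by rewrite word0 -Sword_cat -catA -word1 Sword_cat wbe.
have uc : S u c = c.
  by rewrite /u; elim: (k) => [//|m IHm] /=; rewrite -/(S _ _) IHm /Smap /c; ring.
have u1 : ratio lam u < 1 by rewrite ratio_lt1// size_nseq.
by rewrite (Sword_affine _ _ _ _ c) uc addrC -ltrBrDr gtr_pMl// subr_gt0.
Qed.

(** Iterate the expanding map [f] whose branches invert the two word maps; the branches taken along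
    the orbit of [x] form [e]. *)
Lemma block_seq_addresses (K al be x : R) :
  (forall i, `|p i| <= K) -> `|al| <= K -> `|be| <= K ->
  1 / 2 <= ratio lam (word false) ->
  S (word false) al = al -> S (word true) be = be ->
  al <= x <= be -> exists e, addresses lam p K (block_seq k i0 e) x.
Proof.
move=> pK alK beK; set rho := ratio lam (word false) => r2 wal wbe xab.
have rho0 : 0 < rho by apply: ratio_gt0.
have rho1 : ratio lam (word true) = rho.
  by rewrite /rho /ratio !prod_block_word.
pose e y := (al + be) / 2 < y.
pose f y := if e y then be + (y - be) / rho else al + (y - al) / rho.
have Sf y : S (word (e y)) (f y) = y.
  rewrite /f; case: (e y).
    rewrite (Sword_affine _ _ _ _ be) wbe rho1; field.
    by rewrite gt_eqF.
  rewrite (Sword_affine _ _ _ _ al) wal -/rho; field.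
  by rewrite gt_eqF.
(* The endpoint fixed by the chosen word is within half the length of the interval, and
   [rho >= 1 / 2], so dividing by [rho] stays inside. *)
have fab y : al <= y <= be -> al <= f y <= be.
  move=> /andP[aly ybe]; rewrite /f; case: ifPn; rewrite /e -?leNgt => hy.
    rewrite gerDl -[al](subrK be) [_ + be]addrC lerD2l.
    rewrite ler_pdivlMr// mulr_le0_ge0 ?invr_ge0 ?(ltW rho0) ?subr_le0// andbT.
    by nra.
  rewrite lerDl -[be](subrK al) [_ + al]addrC lerD2l.
  rewrite ler_pdivrMr// divr_ge0 ?(ltW rho0) ?subr_ge0//=.
  by nra.
have orbit q : al <= iter q f x <= be by elim: q => [//|q]; apply: fab.
exists (fun q => e (iter q f x)).
have coded q : compj lam p (block_seq k i0 (fun q => e (iter q f x)))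
    (q * (n.+1 ^ k * k)) (iter q f x) = x.
  elim: q => [//|q IHq].
  by rewrite mulSnr compjD mkseq_block_seq//= Sf.
apply: addresses_cofinal => // m; exists (m * (n.+1 ^ k * k))%N, (iter m f x).
split=> //.
  by rewrite leq_pmulr// muln_gt0 expn_gt0.
by have := orbit m; move: alK beK; rewrite !ler_norml; lra.
Qed.

End Coding.

(** * The open dense set and its null complement *)

Theorem theorem3p3 (R : realType) (n k : nat) (p lam : 'I_n.+1 -> R) (X : set R) :
  (exists i j, p i != p j) ->
  (1 <= k)%N ->
  inPk k lam ->
  is_attractor lam p X ->
  (exists U : set R,
      U `<=` X /\ U `<=` Xk lam p k X /\
      (exists V : set R, open V /\ U = V `&` X) /\
      X `<=` closure U) /\
  (@lebesgue_measure R).-negligible (X `\` Xk lam p k X).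
Proof.
move=> [i1 [i2 p12]] k0 [lam01 lamP] [X0 [Xc XS]].
have n0 : (0 < n)%N.
  case: n p lam i1 i2 p12 {lam01 lamP XS} => // p lam i1 i2.
  by rewrite !ord1 eqxx.
have [i0 pmin] := ord_argmin p.
have [j0 pj0] : exists j, p i0 < p j.
  have := pmin i1; rewrite le_eqVlt => /predU1P[E1|]; last by exists i1.
  exists i2; rewrite lt_neqAle pmin andbT; apply: contraNneq p12 => E2.
  by rewrite -E1 E2.
have [al [be [ab wal wbe]]] :=
  fixed_points lam01 n0 k0 pmin (ex_intro _ j0 pj0).
have Xcl : closed X by apply: compact_closed Xc; exact: norm_hausdorff.
have [M XM] : exists M, forall x, X x -> `|x| <= M.
  have [M [_ HM]] := compact_bounded Xc.
  by exists (M + 1) => x Xx; apply: HM Xx; rewrite ltrDl.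
(* One radius for [X], all [p i], [al] and [be]; the 1 makes it positive. *)
pose K := 1 + `|al| + `|be| + `|M| + \sum_i `|p i|.
have sum0 : 0 <= \sum_i `|p i| by apply: sumr_ge0.
have K1 : 1 <= K by rewrite /K -!addrA lerDl !addr_ge0.
have K0 : 0 < K by rewrite (lt_le_trans _ K1).
have alK : `|al| <= K.
  by rewrite /K; have := normr_ge0 be; have := normr_ge0 M; lra.
have beK : `|be| <= K.
  by rewrite /K; have := normr_ge0 al; have := normr_ge0 M; lra.
have XK x : X x -> `|x| <= K.
  move=> /XM xM; rewrite /K; have := normr_ge0 al; have := normr_ge0 be.
  by have := ler_norm M; lra.
have pK i : `|p i| <= K.
  have : `|p i| <= \sum_i `|p i|.
    by rewrite (bigD1 i)//= lerDl sumr_ge0.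
  rewrite /K; have := normr_ge0 al; have := normr_ge0 be.
  by have := normr_ge0 M; lra.
have r2 : 1 / 2 <= ratio lam (block_word k i0 false).
  by rewrite /ratio prod_block_word.
pose U := \bigcup_(v in [set: seq 'I_n.+1])
  `]Sword lam p v al, Sword lam p v be[%classic.
have Uopen : open U by apply: bigcup_open => v _; exact: itv_open.
(* Prefixing a finite word preserves balance, so good addresses pass from [[al, be]] to all its
   images. *)
have good v y : al <= y <= be ->
    exists2 a, balanced k a & addresses lam p K a (Sword lam p v y).
  move=> aby; elim: v => [|i v [a bal_a adr_a]].
    have [e He] := block_seq_addresses lam01 n0 k0 pK alK beK r2 wal wbe aby.
    by exists (block_seq k i0 e) => //; exact: balanced_block_seq.
  by exists (scons i a); [exact: balanced_scons|exact: addresses_scons].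
have Ugood x : U x -> exists v y, al <= y <= be /\ x = Sword lam p v y.
  move=> [v _]; rewrite /= in_itv/= => /andP[vx xv].
  have r0 := ratio_gt0 lam01 v.
  have xE : x = Sword lam p v (al + (x - Sword lam p v al) / ratio lam v).
    by rewrite (Sword_affine _ _ _ _ al); field; rewrite gt_eqF.
  exists v, (al + (x - Sword lam p v al) / ratio lam v); split=> //.
  by move: vx xv; rewrite {1 2}xE !(ltr_Sword _ lam01) => /ltW -> /ltW ->.
have UX : U `<=` X.
  move=> x /Ugood[v [y [aby ->]]]; have [a _ adr] := good v y aby.
  exact: (attractor_addresses lam01 XS X0 Xcl adr).
have UXk : U `<=` Xk lam p k X.
  move=> x Ux; split; first exact: UX.
  have [v [y [aby ->]]] := Ugood _ Ux; have [a bal_a adr] := good v y aby.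
  exists a; split; first exact: balanced_simply_normal.
  exact: (addresses_cvg lam01).
have [d [D [d0 _ lamdD]]] := lam_bounds lam01.
have lamd i : d <= lam i by case/andP: (lamdD i).
have diam r v y z : ratio lam v <= r -> `|y| <= K -> `|z| <= K ->
    `|Sword lam p v y - Sword lam p v z| <= r * (2 * K).
  move=> vr yK zK; rewrite SwordB normrM gtr0_norm ?ratio_gt0//.
  rewrite ler_pM ?(ltW (ratio_gt0 lam01 _))//.
  by rewrite (le_trans (ler_normB _ _))//; lra.
have [al_mid mid_be] : al < (al + be) / 2 /\ (al + be) / 2 < be by split; lra.
have midK : `|(al + be) / 2| <= K.
  by move: alK beK; rewrite !ler_norml; lra.
split.
  exists U; split=> //; split=> //; split.
    by exists U; split=> //; rewrite setIidl.
  move=> x Xx B /nbhs_ballP[e /= e0 eB].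
  (* A cylinder of at most this ratio has diameter at most [e / 2]. *)
  have r01 : 0 < Num.min 1 (e / (4 * K)) <= 1.
    by rewrite ge_min lexx lt_min ltr01 divr_gt0// mulr_gt0.
  have [v [y [Xy xv /andP[_ vr]]]] :=
    attractor_cylinder lam01 XS (ltW d0) lamd r01 Xx.
  exists (Sword lam p v ((al + be) / 2)); split.
    by exists v => //; rewrite /= in_itv/= !(ltr_Sword _ lam01) al_mid.
  apply: eB; rewrite /ball/= xv.
  move: vr; rewrite le_min => /andP[_ vr].
  apply: le_lt_trans (diam _ _ _ _ vr (XK _ Xy) midK) _.
  have -> : e / (4 * K) * (2 * K) = e / 2 by field; rewrite gt_eqF.
  by rewrite ltr_pdivrMr// ltr_pMr// ltr1n.
have mC : measurable (X `\` U : set (measurableTypeR R)).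
  apply: measurableD; first exact: compact_measurable.
  exact: open_measurable.
exists (X `\` U); split; [exact: mC| |]; last by move=> x [Xx nXk]; split=> // /UXk.
(* The value [1 / 3] serves when the open middle third misses [X] minus [U]. Otherwise a cylinder of
   ratio at least [d * l / (6 * K)], with [l] the length of the interval, carries a gap [be - al]
   times its ratio. *)
pose c := Num.min (1 / 3) (d * (be - al) / (6 * K)).
have K60 : 0 < 6 * K by rewrite mulr_gt0.
have c01 : 0 < c < 1.
  have [t0 t1] : 0 < 1 / 3 :> R /\ 1 / 3 < 1 :> R by split; lra.
  by rewrite lt_min gt_min t0 t1 andbT divr_gt0// mulr_gt0// subr_gt0.
apply: (@porous_measure0 _ _ (- K) K c) => //.
- by rewrite ge0_cp// ltW.
- by move=> x [/XK]; rewrite ler_norml /= in_itv.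
move=> a b Ka lt_ab bK; have [l lE] : exists l, l = b - a by exists (b - a).
have l0 : 0 < l by rewrite lE subr_gt0.
have [hit|miss] := pselect (exists2 x, (X `\` U) x & a + l / 3 < x < b - l / 3);
  last first.
  exists (a + l / 3), (b - l / 3); split; [lra|lra|lra| |].
    have c3 : c <= 1 / 3 by rewrite ge_min lexx.
    by rewrite -lE; apply: (@le_trans _ _ (1 / 3 * l)); [rewrite ler_pM2r|lra].
  apply/seteqP; split=> // x [Cx]; rewrite /= in_itv/= => xm.
  by case: miss; exists x.
have [x [Xx _] /andP[ax xb]] := hit.
(* This ratio bounds the diameter by [l / 3], so the gap near a point of the middle third stays
   within [[a, b]]. *)
have r01 : 0 < l / (6 * K) <= 1.
  by rewrite divr_gt0// ler_pdivrMr// mul1r lE; lra.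
have [v [y [Xy xv /andP[dv vr]]]] :=
  attractor_cylinder lam01 XS (ltW d0) lamd r01 Xx.
have r2K : l / (6 * K) * (2 * K) = l / 3 by field; rewrite gt_eqF.
have := diam _ _ _ _ vr (XK _ Xy) alK; have := diam _ _ _ _ vr (XK _ Xy) beK.
rewrite -xv r2K !ler_norml => /andP[be1 be2] /andP[al1 al2].
exists (Sword lam p v al), (Sword lam p v be); split.
- by lra.
- by rewrite (ler_Sword _ lam01) ltW.
- by lra.
- rewrite SwordB -lE; apply: le_trans (_ : d * (l / (6 * K)) * (be - al) <= _).
    have cle : c <= d * (be - al) / (6 * K) by rewrite ge_min lexx orbT.
    apply: (@le_trans _ _ (d * (be - al) / (6 * K) * l)).
      by rewrite ler_pM2r.
    by rewrite le_eqVlt; apply/orP; left; apply/eqP; field; rewrite gt_eqF.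
  by rewrite ler_pM2r// subr_gt0.
apply/seteqP; split=> // z [[_ nUz] vz].
by apply: nUz; exists v.
Qed.
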